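(* Let $C\subseteq\mathbb{R}^d$ be a rational-preserving Cantor set, i.e. the attractor of an iterated function system $F=(f_1,\ldots,f_J)$ on $\mathbb{R}^d$ with $f_j(\mathbb{Q}^d)\subseteq\mathbb{Q}^d$ for all $1\leq j\leq J$. Assume that there is $f_j\in F$ whose unique fixed point $\underline{\alpha}_j$ lies in $\mathbb{Q}^d$. Assume further that either (i) all contraction maps $f_j\in F$ are one-to-one, or (ii) any element in $C$ has at most countably many addresses (which is true if $C$ satisfies the strong separation condition). Let $\Phi:\mathbb{N}\to\mathbb{R}_{>0}$ be any function that tends to $0$ (arbitrarily slowly). Then the set of irrational $\underline{\xi}\in C$ for which $$\Vert\underline{\xi}-\underline{p}/q\Vert>\frac{\Phi(Q)}{Q}$$ holds for infinitely many positive integers $Q$ and every $\underline{p}/q\in\mathbb{Q}^d\setminus C$ with $1\leq q\leq Q$, is uncountable and dense in $C$.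
   Context: $\mathbb{R}^d$ carries the supremum norm $\Vert\cdot\Vert$. A contraction is a map $f:\mathbb{R}^d\to\mathbb{R}^d$ for which there is $\tau\in(0,1)$ with $\Vert f(\underline{x})-f(\underline{y})\Vert\leq\tau\Vert\underline{x}-\underline{y}\Vert$ for all $\underline{x},\underline{y}\in\mathbb{R}^d$. An iterated function system is a finite set of contractions; its attractor is the unique nonempty compact set $C$ with $\bigcup_{1\leq j\leq J}f_j(C)=C$, and any such $C$ is called a Cantor set. $C$ satisfies the strong separation condition if the sets $f_j(C)$ are disjoint. An address of $\underline{\xi}\in C$ is a sequence $(\omega_1,\omega_2,\ldots)\in\{1,\ldots,J\}^{\mathbb{N}}$ with $\underline{\xi}=\lim_{i\to\infty}f_{\omega_1}\circ\cdots\circ f_{\omega_i}(\underline{0})$. A vector of $\mathbb{R}^d$ is called irrational if it is not in $\mathbb{Q}^d$, i.e. at least one coordinate is irrational. Rational vectors are written $\underline{p}/q$ with $\underline{p}\in\mathbb{Z}^d$ and common denominator $q\in\mathbb{N}$.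
   Formalization: C is assumed not to be a single point (for f(x)=x/2, C={0} has no irrational element); the parenthetical that strong separation implies (ii) is omitted, being false for non-injective maps (f_1=0, f_2(x)=x/2+1). *)

(* Defs.v *)
From HB Require Import structures.
From mathcomp Require Import all_boot all_order all_algebra.
From mathcomp Require Import all_classical all_reals all_analysis.
Set Implicit Arguments.
Unset Strict Implicit.
Unset Printing Implicit Defensive.
Import Order.TTheory GRing.Theory Num.Theory.
Import numFieldNormedType.Exports.
Local Open Scope classical_set_scope.
Local Open Scope ring_scope.

(* R^d is ['rV[R]_d]; its MathComp-Analysis norm is the supremum norm. *)

Definition contraction_map (R : realType) (d : nat)
    (g : 'rV[R]_d -> 'rV[R]_d) : Prop :=
  exists2 tau : R, 0 < tau < 1 &
    forall x y : 'rV[R]_d, `|g x - g y| <= tau * `|x - y|.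

Definition is_ifs (R : realType) (d J : nat)
    (f : 'I_J -> 'rV[R]_d -> 'rV[R]_d) : Prop :=
  forall j, contraction_map (f j).

(* For a family of contractions at most one set satisfies this (Hutchinson),
   so that it determines "the" attractor. *)
Definition is_attractor (R : realType) (d J : nat)
    (f : 'I_J -> 'rV[R]_d -> 'rV[R]_d) (C : set 'rV[R]_d) : Prop :=
  [/\ C !=set0, compact C & \bigcup_(j in [set: 'I_J]) (f j @` C) = C].

(* [foldr f 0 [:: w 0; ...; w i.-1]] is f_{w 0} (... (f_{w i.-1} 0)):
   addresses are indexed from 0. *)
Definition is_address (R : realType) (d J : nat)
    (f : 'I_J -> 'rV[R]_d -> 'rV[R]_d) (xi : 'rV[R]_d)
    (w : nat -> 'I_J) : Prop :=
  (fun i : nat => foldr f 0 (mkseq w i)) @ \oo --> xi.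

(* The set Q^d. *)
Definition rational_vec (R : realType) (d : nat) : set 'rV[R]_d :=
  [set x | forall i, rational (x 0 i)].

Definition rational_preserving (R : realType) (d J : nat)
    (f : 'I_J -> 'rV[R]_d -> 'rV[R]_d) : Prop :=
  forall j, f j @` @rational_vec R d `<=` @rational_vec R d.

(* The vector p / q; q need not be the least common denominator. *)
Definition frac_vec (R : realType) (d : nat) (p : 'rV[int]_d) (q : nat) :
    'rV[R]_d :=
  q%:R^-1 *: map_mx intr p.

Definition badly_approx_at (R : realType) (d : nat) (C : set 'rV[R]_d)
    (Phi : nat -> R) (xi : 'rV[R]_d) (Q : nat) : Prop :=
  forall (p : 'rV[int]_d) (q : nat), (1 <= q <= Q)%N ->
    ~ C (frac_vec R p q) -> Phi Q / Q%:R < `|xi - frac_vec R p q|.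

Definition badly_approx_set (R : realType) (d : nat) (C : set 'rV[R]_d)
    (Phi : nat -> R) : set 'rV[R]_d :=
  [set xi | [/\ C xi, ~ rational_vec xi &
     infinite_set [set Q : nat | (0 < Q)%N /\ badly_approx_at C Phi xi Q]]].

(* Main.v *)
Require Import Defs.
From HB Require Import structures.
From mathcomp Require Import all_boot all_order all_algebra.
From mathcomp Require Import all_classical all_reals all_analysis.
From mathcomp Require Import ring lra.
Import Order.TTheory GRing.Theory Num.Theory.
Import numFieldNormedType.Exports.
Local Open Scope classical_set_scope.
Local Open Scope ring_scope.

(** Baire category in the compact set [C].  A rational point [r] of [C] has
    distance at least [c / q] to every fraction [p / q <> r], so all points
    close to [r] are badly approximable at level [Q] as soon as
    [Phi Q < c / 2]; hence the points that are badly approximable at some level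
    above [N] contain an open set around the orbit of the rational fixed point,
    which is dense in [C].  In both cases [C] is perfect: if a cylinder reduces
    to a point although [C] does not, then some [f j] is not injective, and
    every continuation of the cylinder's word is an address of that point.  So
    the intersection over [N] stays dense after removing any countable set,
    such as the rational points together with an enumeration of candidates. *)

(** * Baire category in a compact set *)

(** Compactness stands in for completeness: the centres of nested closed balls stay in [C] and
    cluster at a point of [C] lying in every ball. *)
Lemma compact_baire (R : realFieldType) (V : normedModType R) (C : set V)
    (U : nat -> set V) :
  compact C -> (forall n, open (U n)) ->
  (forall n, C `<=` closure (C `&` U n)) ->
  C `<=` closure (C `&` \bigcap_n U n).
Proof.
move=> cC oU dU x Cx B /nbhs_closedballP[r0 r0B].
pose ball' (b : V * {posnum R}) := closed_ball b.1 b.2%:num.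
(* The implication sits under the existential so that [choice] gives a total function; centres
   outside [C] get a dummy ball. *)
have step (na : nat * (V * {posnum R})) : exists b : V * {posnum R},
    C na.2.1 -> [/\ C b.1, ball' b `<=` ball' na.2 & ball' b `<=` U na.1].
  case: na => n a; have [Ca|nCa] := pselect (C a.1); last by exists a.
  have /(dU n a.1 Ca)[y [[Cy Uy] ay]] : nbhs a.1 (ball' a)^°.
    apply: open_nbhs_nbhs; split; first exact: open_interior.
    by apply/nbhs_closedballP; exists a.2.
  have /nbhs_closedballP[r rP] : nbhs y (ball' a `&` U n).
    by apply: filterI => //; exact: open_nbhs_nbhs.
  by exists (y, r) => _; split=> // z /rP[].
have [g gP] := choice step.
pose ar := fix ar n := if n is m.+1 then g (m, ar m) else (x, r0).
have Car n : C (ar n).1 by elim: n => //= n /(gP (n, ar n))[].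
have nest n m : (n <= m)%N -> ball' (ar m) `<=` ball' (ar n).
  elim: m => [|m IH]; first by rewrite leqn0 => /eqP ->.
  rewrite leq_eqVlt => /predU1P[-> //|]; rewrite ltnS => /IH.
  by apply: subset_trans; have [] := gP (m, ar m) (Car m).
have [|p [Cp clp]] := cC ((fun n => (ar n).1) @ \oo).
  by exists 0%N => // n _; exact: Car.
have pball n : ball' (ar n) p.
  apply: closed_ball_closed => W Wp; apply: clp => //.
  exists n => // m /= nm; apply: (nest _ _ nm); exact: closed_ballxx.
exists p; split; last by apply: r0B; exact: (pball 0%N).
by split=> // n _; have [_ _] := gP (n, ar n) (Car n); apply; exact: (pball n.+1).
Qed.

(** The countable set is absorbed into Baire: [W n] drops from [U n] the point of [A] numbered [n],
    if any, and stays dense since [C] has no isolated point. *)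
Lemma perfect_compact_baire (R : realFieldType) (V : normedModType R)
    (C A : set V) (U : nat -> set V) :
  compact C -> C `<=` limit_point C -> countable A ->
  (forall n, open (U n)) -> (forall n, C `<=` closure (C `&` U n)) ->
  C `<=` closure (C `&` (\bigcap_n U n `\` A)).
Proof.
move=> cC pC /countable_injP[g gI] oU dU x Cx.
pose W n := U n `&` ~` [set a | A a /\ g a = n].
have A1 n : is_subset1 [set a | A a /\ g a = n].
  by move=> a b [Aa <-] [Ab gab]; apply: gI; rewrite ?inE.
have oW n : open (W n).
  apply: openI => //; apply: closed_openC.
  have [->|/set0P[a [Aa ga]]] := eqVneq [set a | A a /\ g a = n] set0.
    exact: closed0.
  suff -> : [set a | A a /\ g a = n] = [set a].
    exact/accessible_closed_set1/hausdorff_accessible/norm_hausdorff.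
  by apply/seteqP; split=> [b bA|_ ->] //; apply: (A1 n).
have dW n : C `<=` closure (C `&` W n).
  move=> y Cy B By.
  have [z [[Cz Uz] Bz]] := dU n y Cy _ (open_nbhs_nbhs (conj (@open_interior _ B) By)).
  have Vz : nbhs z (U n `&` B).
    by apply: filterI => //; apply: open_nbhs_nbhs.
  (* If [z] is the dropped point, a second point [t] of [C] near it takes its place. *)
  have [t [tz Ct [Ut Bt]]] := pC z Cz _ Vz.
  have [Az|nAz] := pselect (A z /\ g z = n); last first.
    by exists z; split => //; exact: interior_subset.
  exists t; split => //; split => //; split=> // At.
  by move/eqP: tz; apply; exact: (A1 n).
apply: (closureS _ (compact_baire _ _ _ _ cC oW dW x Cx)).
move=> y [Cy Wy]; split => //; split=> [n _|Ay]; first by have [] := Wy n I.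
by have [_] := Wy (g y) I; apply.
Qed.

(** * Contraction ratios and sequences of letters *)

Lemma ifs_uniform_ratio (R : realType) (d J : nat)
    (f : 'I_J -> 'rV[R]_d -> 'rV[R]_d) :
  is_ifs f -> exists2 tau : R, 0 < tau < 1 &
    forall j x y, `|f j x - f j y| <= tau * `|x - y|.
Proof.
move=> hf; have /choice[t tP] : forall j, exists t : R,
    0 < t < 1 /\ forall x y, `|f j x - f j y| <= t * `|x - y|.
  by move=> j; have [t] := hf j; exists t.
(* The default [2^-1] keeps the maximum strictly between 0 and 1 even if [J = 0]. *)
exists (\big[Num.max/2^-1]_j t j).
  apply/andP; split.
    by apply: lt_le_trans (bigmax_ge_id _ _ _ _); rewrite invr_gt0.
  apply: bigmax_lt => [|j _]; first by rewrite invf_lt1 ?ltr1n.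
  by have [/andP[]] := tP j.
move=> j x y; have [_ /(_ x y)/le_trans] := tP j; apply.
by apply: ler_wpM2r => //; exact: le_bigmax.
Qed.

Lemma exists_geometric_lt (R : realType) (tau D e : R) :
  0 < tau < 1 -> 0 < e -> exists n : nat, tau ^+ n * D < e.
Proof.
move=> /andP[t0 t1] e0.
have taun : `|tau| < 1 by rewrite gtr0_norm.
by have /cvgr_lt := cvg_geometric D taun; move=> /(_ e e0)[n _ /(_ n (leqnn n))]; exists n; rewrite mulrC.
Qed.

Lemma uncountable_image_sequences (T : Type) (A : set T)
    (h : (nat -> bool) -> T) :
  injective h -> (forall s, A (h s)) -> ~ countable A.
Proof.
move=> hI hA /countable_injP[g gI].
have ghI s t : g (h s) = g (h t) -> s = t.
  by move=> st; apply/hI/gI; rewrite ?inE.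
(* Cantor's diagonal: [s] differs from each [t] at the index [g (h t)]. *)
pose s n := `[< exists2 t, g (h t) = n & ~~ t n >].
have [sg|/negP sg] := boolP (s (g (h s))).
  by have /asboolP[t /ghI -> /negP] := sg; apply.
by apply: (sg); apply/asboolP; exists s => //; apply/negP.
Qed.

(* [nth] returns its default value exactly past the end of [v]. *)
Definition prepend (T : Type) (v : seq T) (u : nat -> T) (i : nat) : T :=
  nth (u (i - size v)%N) v i.

Lemma mkseq_prepend (T : Type) (v : seq T) (u : nat -> T) (m : nat) :
  mkseq (prepend _ v u) (size v + m) = v ++ mkseq u m.
Proof.
apply: (@eq_from_nth _ (u 0%N)) => [|i]; rewrite size_mkseq.
  by rewrite size_cat size_mkseq.
move=> im; rewrite nth_mkseq// nth_cat /prepend; case: ltnP => vi.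
  exact: set_nth_default.
by rewrite nth_default// nth_mkseq// ltn_subLR.
Qed.

Lemma prependI (T : Type) (v : seq T) : injective (prepend _ v).
Proof.
move=> u u' uE; apply/funext => m; have /= := congr1 (@^~ (size v + m)%N) uE.
by rewrite /prepend !nth_default ?leq_addr// addKn.
Qed.

(** * Cylinders and addresses of an attractor *)

Section IteratedFunctionSystem.
Variables (R : realType) (d J : nat) (f : 'I_J -> 'rV[R]_d -> 'rV[R]_d).
Implicit Types (x y : 'rV[R]_d) (w : seq 'I_J) (C : set 'rV[R]_d).

Lemma foldr_contraction (tau : R) w x y :
  0 < tau -> (forall j x y, `|f j x - f j y| <= tau * `|x - y|) ->
  `|foldr f x w - foldr f y w| <= tau ^+ size w * `|x - y|.
Proof.
move=> t0 ft; elim: w => [|j w IH] /=; first by rewrite expr0 mul1r.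
by apply: (le_trans (ft _ _ _)); rewrite exprS -mulrA ler_pM2l.
Qed.

Lemma foldr_attractor C w x : is_attractor f C -> C x -> C (foldr f x w).
Proof.
move=> [_ _ CE] Cx; elim: w => //= j w IH.
by rewrite -CE; exists j => //; exists (foldr f x w).
Qed.

Lemma attractor_cylinder C n x : is_attractor f C -> C x ->
  exists w y, [/\ size w = n, C y & foldr f y w = x].
Proof.
move=> [_ _ CE]; elim: n x => [|n IH] x Cx; first by exists [::], x.
move: Cx; rewrite -{1}CE => -[j _ [z Cz <-]].
by have [w [y [<- Cy <-]]] := IH z Cz; exists (j :: w), y.
Qed.

(** Iterating [f j] from any point of [C] stays in [C] and converges to [x], and [C] is closed. *)
Lemma fixpoint_attractor C j x : is_ifs f -> is_attractor f C ->
  f j x = x -> C x.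
Proof.
move=> hf hC fx; have [tau tau01 ft] := ifs_uniform_ratio _ _ _ _ hf.
have [[c Cc] cC _] := hC.
apply: (compact_closed (@norm_hausdorff _ _) cC) => B /nbhs_ballP[e /= e0 eB].
have [n ne] := exists_geometric_lt _ _ `|x - c| _ tau01 e0.
exists (foldr f c (nseq n j)); split; first exact: foldr_attractor.
apply: eB; rewrite -ball_normE /=.
have {1}<- : foldr f x (nseq n j) = x by elim: (n) => //= m ->.
have /andP[t0 _] := tau01.
by apply: (le_lt_trans (foldr_contraction tau _ _ _ t0 ft)); rewrite size_nseq.
Qed.

Lemma attractor_small_cylinder C x (B : set 'rV[R]_d) :
  is_ifs f -> is_attractor f C -> C x -> nbhs x B ->
  exists w y, [/\ C y, foldr f y w = x & forall z, C z -> B (foldr f z w)].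
Proof.
move=> hf hC Cx /nbhs_ballP[e /= e0 eB].
have [tau tau01 ft] := ifs_uniform_ratio _ _ _ _ hf.
have [M M0 CM] : exists2 M, 0 < M & forall z, C z -> `|z| < M.
  have [_ /compact_bounded/ex_strict_bound_gt0[M M0 MP] _] := hC.
  by exists M.
(* [M + M] bounds the diameter of [C], so cylinders of length [n] have diameter below [e]. *)
have [n ne] := exists_geometric_lt _ _ (M + M) _ tau01 e0.
have [w [y [wn Cy yE]]] := attractor_cylinder _ n _ hC Cx.
exists w, y; split=> // z Cz.
apply: eB; rewrite -ball_normE /= -yE.
have /andP[t0 _] := tau01.
apply: (le_lt_trans (foldr_contraction tau _ _ _ t0 ft)); rewrite wn.
apply: le_lt_trans ne; rewrite ler_pM2l ?exprn_gt0//.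
by rewrite (le_trans (ler_normB _ _))// lerD// ltW// CM.
Qed.

Lemma orbit_dense C x : is_ifs f -> is_attractor f C -> C x ->
  C `<=` closure [set foldr f x w | w in setT].
Proof.
move=> hf hC Cx y Cy B By.
have [w [_ [_ _ wB]]] := attractor_small_cylinder _ _ _ hf hC Cy By.
by exists (foldr f x w); split; [exists w | exact: wB].
Qed.

(** With a single letter there is one word of each length, so any two points share arbitrarily small
    cylinders. *)
Lemma attractor_two_letters C : is_ifs f -> is_attractor f C ->
  ~ is_subset1 C -> exists a b : 'I_J, a != b.
Proof.
move=> hf hC C1; apply: contrapT => /forallNP ab; apply: C1 => x y Cx Cy.
have {}ab (a b : 'I_J) : a = b.
  by have /forallNP/(_ b)/negP := ab a; rewrite negbK => /eqP.
apply/eqP; apply: contrapT => /negP xy.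
have [|w [z [_ _ wC]]] := attractor_small_cylinder _ x (~` [set y]) hf hC Cx.
  apply: open_nbhs_nbhs; split; last exact/eqP.
  exact/closed_openC/accessible_closed_set1/hausdorff_accessible/norm_hausdorff.
have [v [u [vw Cu uy]]] := attractor_cylinder _ (size w) _ hC Cy.
apply: (wC u Cu); rewrite -uy; congr foldr.
by elim: v w vw {wC uy} => [|b v IH] [|a w] //= [vw]; rewrite (ab a b) (IH w).
Qed.

(** Initial words of [u] map [C] into [C], which [v] then collapses to [x]; hence the tail [u] is
    arbitrary. *)
Lemma prepend_is_address C v x (u : nat -> 'I_J) : is_ifs f ->
  is_attractor f C -> (forall z, C z -> foldr f z v = x) ->
  is_address f x (prepend _ v u).
Proof.
move=> hf hC vx; have [tau tau01 ft] := ifs_uniform_ratio _ _ _ _ hf.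
have /andP[t0 t1] := tau01.
have [[c Cc] _ _] := hC.
apply/cvgrPdist_lt => e e0.
have [n ne] := exists_geometric_lt _ _ `|c| _ tau01 e0.
exists (size v + n)%N => // i /= /subnK <-.
set m := (_ - _)%N; rewrite addnC -addnA mkseq_prepend.
(* The whole word sends [c] exactly to [x]; the address starts from [0] instead, so the error is at
   most a power of [tau] times [|c|]. *)
rewrite -{1}(vx (foldr f c (mkseq u (n + m)))); last exact: foldr_attractor.
rewrite -foldr_cat; apply: (le_lt_trans (foldr_contraction tau _ _ _ t0 ft)).
apply: le_lt_trans ne; rewrite subr0 ler_wpM2r//.
by rewrite ler_wiXn2l ?(ltW t0) ?(ltW t1)// size_cat size_mkseq addnCA leq_addr.
Qed.

Lemma attractor_limit_point C : is_ifs f -> is_attractor f C ->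
  ~ is_subset1 C ->
  (forall j, injective (f j)) \/
    (forall xi, C xi -> countable [set w | is_address f xi w]) ->
  C `<=` limit_point C.
Proof.
move=> hf hC C1 hcase x Cx B Bx; apply: contrapT => /forallNP isox.
have [w [c [Cc cx wB]]] := attractor_small_cylinder _ _ _ hf hC Cx Bx.
(* The cylinder of [w] lies in the isolating neighbourhood [B], so it is the single point [x]. *)
have {wB}wx z : C z -> foldr f z w = x.
  move=> Cz; apply/eqP; apply: contrapT => /negP zx.
  apply: (isox (foldr f z w)); split=> //; last exact: wB.
  exact: foldr_attractor.
case: hcase => [fI|/(_ x Cx)ctb].
  apply: C1 => y z Cy Cz.
  have : foldr f y w = foldr f z w by rewrite !wx.
  by elim: (w) => //= j v IH /fI.
have [a [b ab]] := attractor_two_letters _ hf hC C1.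
(* Two distinct letters encode binary sequences injectively as addresses of [x]. *)
pose word (s : nat -> bool) := prepend _ w (fun n => if s n then a else b).
have wordI : injective word.
  move=> s t /prependI st; apply/funext => n; have /= := congr1 (@^~ n) st.
  by case: (s n) (t n) => [] [] // E; move: ab; rewrite E eqxx.
apply: (uncountable_image_sequences _ _ word wordI _ ctb) => s.
exact: (prepend_is_address _ _ _ _ hf hC wx).
Qed.

End IteratedFunctionSystem.

(** * Rational vectors and their distance to fractions *)

Lemma rational_vec_foldr (R : realType) (d J : nat)
    (f : 'I_J -> 'rV[R]_d -> 'rV[R]_d) (x : 'rV[R]_d) (w : seq 'I_J) :
  rational_preserving f -> rational_vec x -> rational_vec (foldr f x w).
Proof.
by move=> hQ xQ; elim: w => //= j w IH; apply: (hQ j); exists (foldr f x w).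
Qed.

Lemma countable_rational_vec (R : realType) (d : nat) :
  countable (@rational_vec R d).
Proof.
have : countable (map_mx (@ratr R) @` [set: 'rV[rat]_d]).
  by apply: sub_countable (card_image_le _ _) _; exact: countableP.
apply: sub_countable; apply: subset_card_le => x xQ.
have /choice[q qx] : forall i, exists q : rat, ratr q = x 0 i.
  by move=> i; have [q _ <-] := xQ i; exists q.
by exists (\row_i q i) => //; apply/rowP => i; rewrite !mxE qx.
Qed.

Lemma ler_entry_norm (R : realDomainType) (m n : nat) (A : 'M[R]_(m, n)) i j :
  `|A i j| <= `|A|.
Proof.
rewrite [leRHS]mx_normrE.
exact: (le_bigmax 0 (fun ij : 'I_m * 'I_n => `|A ij.1 ij.2|) (i, j)).
Qed.

(** Over the common denominator [denq s * q] the difference has a nonzero integer numerator, hence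
    one of absolute value at least 1. *)
Lemma rat_frac_dist (R : realType) (s : rat) (p : int) (q : nat) :
  (0 < q)%N -> q%:R^-1 * p%:~R != ratr s :> R ->
  (denq s)%:~R^-1 / q%:R <= `|ratr s - q%:R^-1 * p%:~R| :> R.
Proof.
move=> q0 sne.
have d0 : 0 < (denq s)%:~R :> R by rewrite ltr0z denq_gt0.
have qR : 0 < q%:R :> R by rewrite ltr0n.
have E : ratr s - q%:R^-1 * p%:~R =
    (numq s * q%:Z - p * denq s)%:~R * ((denq s)%:~R^-1 / q%:R) :> R.
  rewrite /ratr rmorphB !rmorphM /= -pmulrn.
  by field; rewrite (gt_eqF qR) (gt_eqF d0).
rewrite eq_sym -subr_eq0 E in sne; rewrite E normrM.
have c0 : 0 < (denq s)%:~R^-1 / q%:R :> R by rewrite divr_gt0 ?invr_gt0.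
rewrite (gtr0_norm c0) ler_pMl// -intr_norm ler1z -gtz0_ge1 normr_gt0.
by apply: contraNneq sne => ->; rewrite mul0r.
Qed.

(** Some coordinate differs, and in the supremum norm it alone gives the bound; [c] is the minimum
    of 1 and the reciprocal denominators. *)
Lemma rational_vec_dist (R : realType) (d : nat) (x : 'rV[R]_d) :
  rational_vec x -> exists2 c : R, 0 < c &
    forall p q, (0 < q)%N -> frac_vec R p q <> x ->
      c / q%:R <= `|x - frac_vec R p q|.
Proof.
move=> xQ; have /choice[s sx] : forall i, exists s : rat, ratr s = x 0 i.
  by move=> i; have [s _ <-] := xQ i; exists s.
exists (\big[Num.min/1]_i (denq (s i))%:~R^-1).
  by apply: lt_bigmin => // i _; rewrite invr_gt0 ltr0z denq_gt0.
move=> p q q0 pqx.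
have [i pqxi] : exists i, frac_vec R p q 0 i != x 0 i.
  by apply: contrapT => /forallNP xpq; apply: pqx; apply/rowP => i;
     apply/eqP; have /negP := xpq i; rewrite negbK.
have pqE : frac_vec R p q 0 i = q%:R^-1 * (p 0 i)%:~R by rewrite !mxE.
apply: (le_trans _ (ler_entry_norm _ _ _ _ 0 i)); rewrite !mxE.
rewrite pqE -sx in pqxi; rewrite -sx; apply: (le_trans _ (rat_frac_dist _ _ _ _ q0 pqxi)).
by rewrite ler_pM2r ?invr_gt0 ?ltr0n//; exact: bigmin_le.
Qed.

(** * Badly approximable points *)

Lemma badly_approx_near_rational (R : realType) (d : nat) (C : set 'rV[R]_d)
    (Phi : nat -> R) (x : 'rV[R]_d) (N : nat) :
  Phi @ \oo --> (0 : R) -> C x -> rational_vec x ->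
  exists2 Q, (N < Q)%N & nbhs x [set xi | badly_approx_at C Phi xi Q].
Proof.
move=> Phi0 Cx /rational_vec_dist[c c0 cP].
have c20 : 0 < c / 2 by rewrite divr_gt0.
have /cvgr_lt/(_ (c / 2) c20)[n _ nP] := Phi0.
pose Q := (maxn n N).+1.
have Q0 : 0 < Q%:R :> R by rewrite ltr0n.
exists Q; first by rewrite ltnS leq_maxr.
(* Half of the gap [c / Q] pays for moving from [x] to [y]; the other half exceeds [Phi Q / Q]. *)
apply/nbhs_ballP; exists (c / 2 / Q%:R) => /=; first by rewrite divr_gt0.
move=> y; rewrite -ball_normE /= => xy p q /andP[q0 qQ] Cpq.
have PhiQ : Phi Q < c / 2 by apply: nP; rewrite /= leqW// leq_maxl.
have : c / Q%:R <= `|x - frac_vec R p q|.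
  apply: (@le_trans _ _ (c / q%:R)).
    by rewrite ler_pM2l// lef_pV2 ?posrE ?ltr0n// ler_nat.
  by apply: cP => // E; apply: Cpq; rewrite E.
have := ler_distD y x (frac_vec R p q).
have : Phi Q / Q%:R < c / 2 / Q%:R by rewrite ltr_pM2r ?invr_gt0.
have -> : c / Q%:R = c / 2 / Q%:R + c / 2 / Q%:R by field; rewrite gt_eqF.
lra.
Qed.

Lemma unbounded_infinite_set (A : set nat) :
  (forall N, exists2 n, A n & (N < n)%N) -> infinite_set A.
Proof.
move=> hA /finite_fsetP[X AX]; have [n] := hA (\max_(i <- finmap.enum_fset X) i).
by rewrite AX /= => nX; rewrite ltnNge leq_bigmax_seq.
Qed.

Lemma countable_setU (T : Type) (A B : set T) :
  countable A -> countable B -> countable (A `|` B).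
Proof.
move=> cA cB; rewrite -bigcup2E; apply: bigcup_countable => //.
by move=> [|[|n]] _ //=; exact: countable0.
Qed.

Theorem theorem3p2 (R : realType) (d J : nat)
    (f : 'I_J -> 'rV[R]_d -> 'rV[R]_d) (C : set 'rV[R]_d)
    (Phi : nat -> R)
    (hd : (0 < d)%N)
    (hf : is_ifs f)
    (hC : is_attractor f C)
    (* C is not a single point; otherwise the claim fails, e.g. for C = {0}. *)
    (hC1 : ~ is_subset1 C)
    (hQ : rational_preserving f)
    (hfix : exists (j : 'I_J) (alpha : 'rV[R]_d),
       f j alpha = alpha /\ rational_vec alpha)
    (hcase : (forall j, injective (f j)) \/
       (forall xi, C xi -> countable [set w | is_address f xi w]))
    (hPhi_pos : forall Q : nat, (0 < Q)%N -> 0 < Phi Q)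
    (hPhi_lim : Phi @ \oo --> (0 : R)) :
  ~ countable (badly_approx_set C Phi) /\
  C `<=` closure (badly_approx_set C Phi).
Proof.
have [j [alpha [falpha alphaQ]]] := hfix.
have Calpha : C alpha := fixpoint_attractor _ _ _ _ _ _ _ hf hC falpha.
have pC : C `<=` limit_point C := attractor_limit_point _ _ _ _ _ hf hC hC1 hcase.
have [C0 cC _] := hC.
(* Interiors make [U N] open; a point in all [U N] is badly approximable at levels beyond every
   bound. *)
pose U N := \bigcup_(Q in [set Q | (N < Q)%N])
  [set xi | badly_approx_at C Phi xi Q]^°.
have oU N : open (U N) by apply: bigcup_open => Q _; exact: open_interior.
have dU N : C `<=` closure (C `&` U N).
  move=> x Cx; apply: (closureS _ (orbit_dense _ _ _ _ _ _ hf hC Calpha x Cx)).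
  move=> _ [w _ <-].
  have Cw : C (foldr f alpha w) by exact: foldr_attractor.
  have wQ : rational_vec (foldr f alpha w) by exact: rational_vec_foldr.
  split=> //.
  by have [Q NQ ?] := badly_approx_near_rational _ _ _ _ _ N hPhi_lim Cw wQ; exists Q.
have UB x : C x -> (\bigcap_N U N) x -> ~ rational_vec x ->
    badly_approx_set C Phi x.
  move=> Cx Ux xQ; split=> //; apply: unbounded_infinite_set => N.
  have [Q NQ /interior_subset Qx] := Ux N I.
  by exists Q => //; split=> //; exact: leq_ltn_trans NQ.
split; last first.
  apply: subset_trans (perfect_compact_baire _ _ _ _ _ cC pC
    (countable_rational_vec R d) oU dU) _.
  by apply: closureS => x [Cx [Ux xQ]]; exact: UB.
(* Were the set countable, removing it along with the rational vectors would still leave a point of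
   every [U N], which belongs to the set. *)
move=> Bctb; have [x Cx] := C0.
have QBctb : countable (@rational_vec R d `|` badly_approx_set C Phi).
  by apply: countable_setU => //; exact: countable_rational_vec.
have [y [[Cy [Uy /not_orP[yQ yB]]] _]] :=
  perfect_compact_baire _ _ _ _ _ cC pC QBctb oU dU x Cx setT filterT.
exact/yB/UB.
Qed.
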